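(* Every spherical latin trade can be embedded in a finite abelian group.
   Context: A partial latin square (PLS) is a finite set $P\subseteq R\times C\times S$ of triples (row, column, symbol) such that any two distinct triples agree in at most one coordinate. A latin bitrade is a pair $(W,B)$ of non-empty PLS such that for each $(r,c,s)\in W$ (respectively $B$) there exist unique $r'\ne r$, $c'\ne c$, $s'\ne s$ with $(r',c,s),(r,c',s),(r,c,s')\in B$ (respectively $W$). It is connected if there are no latin bitrades $(W',B')$, $(W'',B'')$ with $W'\cap W''=\emptyset$, $W=W'\cup W''$, $B=B'\cup B''$. With $R,C,S$ the (pairwise disjoint) sets of used rows, columns, symbols: for a row $r$, $\psi_r$ is the permutation of symbols in row $r$ with $\psi_r(s)=s'$ iff $(r,c,s)\in W$, $(r,c,s')\in B$ for some $c$; analogous permutations are defined for columns and symbols; the bitrade is separated if all these permutations are single cycles. A separated connected bitrade has genus $\tfrac12(2+|W|-|R|-|C|-|S|)$. A latin trade $W$ is spherical if there is $B$ with $(W,B)$ a separated connected latin bitrade of genus $0$. A PLS $P$ embeds in a group $G$ if there are injections $f:R\to G$, $h:C\to G$, $k:S\to G$ with $f(r)h(c)=k(s)$ for all $(r,c,s)\in P$. *)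

(* Defs.v *)
From mathcomp Require Import all_boot all_order all_algebra all_fingroup.
Set Implicit Arguments.
Unset Strict Implicit.
Unset Printing Implicit Defensive.

Section LatinBitrades.

(* R, C and S may contain unused rows, columns and symbols; the sets written
   R, C, S in the literature are used_rows, used_cols and used_syms below.
   Being distinct index types, they need no disjointness assumption. *)
Variables R C S : finType.
Implicit Types (P W B : {set R * C * S}) (r : R) (c : C) (s : S).

Definition is_pls P : Prop :=
  forall t u : R * C * S, t \in P -> u \in P -> t != u ->
  (t.1.1 == u.1.1) + (t.1.2 == u.1.2) + (t.2 == u.2) <= 1.

Definition has_mates W B : Prop :=
  forall r c s, (r, c, s) \in W ->
  [/\ exists! r', r' != r /\ (r', c, s) \in B,
      exists! c', c' != c /\ (r, c', s) \in B
    & exists! s', s' != s /\ (r, c, s') \in B].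

Definition latin_bitrade W B : Prop :=
  [/\ W != set0, B != set0, is_pls W & is_pls B] /\
  (has_mates W B /\ has_mates B W).

Definition connected_bitrade W B : Prop :=
  ~ exists W1 B1 W2 B2 : {set R * C * S},
      [/\ latin_bitrade W1 B1, latin_bitrade W2 B2,
          W1 :&: W2 = set0, W = W1 :|: W2 & B = B1 :|: B2].

Definition used_rows P : {set R} := [set t.1.1 | t in P].
Definition used_cols P : {set C} := [set t.1.2 | t in P].
Definition used_syms P : {set S} := [set t.2 | t in P].

Definition syms_of_row P r : {set S} := [set s | [exists c, (r, c, s) \in P]].
Definition rows_of_col P c : {set R} := [set r | [exists s, (r, c, s) \in P]].
Definition cols_of_sym P s : {set C} := [set c | [exists r, (r, c, s) \in P]].

(* The graphs of the permutations psi_r, psi_c, psi_s; those of columns and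
   symbols are obtained from that of rows by rotating (row, column, symbol). *)
Definition row_graph W B r : rel S :=
  fun s s' => [exists c, ((r, c, s) \in W) && ((r, c, s') \in B)].
Definition col_graph W B c : rel R :=
  fun r r' => [exists s, ((r, c, s) \in W) && ((r', c, s) \in B)].
Definition sym_graph W B s : rel C :=
  fun c c' => [exists r, ((r, c, s) \in W) && ((r, c', s) \in B)].

(* psi is the permutation of A with graph e, extended by the identity. *)
Definition perm_with_graph (T : finType) (A : {set T}) (e : rel T)
    (psi : {perm T}) : Prop :=
  perm_on A psi /\ forall x y, x \in A -> (psi x = y <-> e x y).

Definition single_cycle (T : finType) (A : {set T}) (psi : {perm T}) : Prop :=
  forall x, x \in A -> porbit psi x = A.

(* In a bitrade the permutations quantified here exist and are unique: see
   perm_with_graph_uniq, row_perm_ex, col_perm_ex and sym_perm_ex. *)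
Definition separated W B : Prop :=
  [/\ forall r, r \in used_rows W -> exists2 psi,
        perm_with_graph (syms_of_row W r) (row_graph W B r) psi &
        single_cycle (syms_of_row W r) psi,
      forall c, c \in used_cols W -> exists2 psi,
        perm_with_graph (rows_of_col W c) (col_graph W B c) psi &
        single_cycle (rows_of_col W c) psi
    & forall s, s \in used_syms W -> exists2 psi,
        perm_with_graph (cols_of_sym W s) (sym_graph W B s) psi &
        single_cycle (cols_of_sym W s) psi].

Definition genus W : rat :=
  ((2 + #|W|%:R - #|used_rows W|%:R - #|used_cols W|%:R - #|used_syms W|%:R)
     / 2)%R.

Definition spherical_trade W : Prop :=
  exists B, [/\ latin_bitrade W B, separated W B, connected_bitrade W B
              & genus W = 0%R].

Definition embeds_in P (G : groupType) : Prop :=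
  exists (f : R -> G) (h : C -> G) (k : S -> G),
    [/\ {in used_rows P &, injective f}, {in used_cols P &, injective h},
        {in used_syms P &, injective k}
      & forall r c s, (r, c, s) \in P -> (f r * h c)%g = k s].

Lemma perm_with_graph_uniq (T : finType) (A : {set T}) (e : rel T) p q :
  perm_with_graph A e p -> perm_with_graph A e q -> p = q.
Proof.
move=> [pA pe] [qA qe]; apply/permP => x.
have [xA|xA] := boolP (x \in A); last by rewrite !(out_perm _ xA).
by apply/esym/(qe _ _ xA)/(pe _ _ xA).
Qed.

Lemma perm_with_graph_ex (T : finType) (A : {set T}) (e : rel T) :
  (forall x, x \in A -> exists y, e x y) ->
  (forall x y, e x y -> y \in A) ->
  (forall x y z, e x y -> e x z -> y = z) ->
  (forall x y z, e x z -> e y z -> x = y) ->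
  exists psi, perm_with_graph A e psi.
Proof.
move=> eT eA eF eI.
pose f x := if x \in A then odflt x [pick y | e x y] else x.
have fe x : x \in A -> e x (f x).
  move=> xA; rewrite /f xA; case: pickP => //= ne.
  by have [y] := eT x xA; rewrite ne.
have fI : injective f.
  move=> x y; have [xA|xA] := boolP (x \in A); have [yA|yA] := boolP (y \in A).
  - by move=> fxy; apply: (eI _ _ (f x)); [exact: fe | rewrite fxy; exact: fe].
  - move=> fxy; move: (eA _ _ (fe x xA)); rewrite fxy /f (negPf yA).
    by rewrite (negPf yA).
  - move=> fxy; move: (eA _ _ (fe y yA)); rewrite -fxy /f (negPf xA).
    by rewrite (negPf xA).
  - by rewrite /f (negPf xA) (negPf yA).
exists (perm fI); split.
  by apply/subsetP => x; rewrite inE permE /f; case: ifP => //; rewrite eqxx.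
move=> x y xA; rewrite permE; split=> [<-|exy]; first exact: fe.
exact: eF (fe x xA) exy.
Qed.

Lemma pls_sym P r c s s' :
  is_pls P -> (r, c, s) \in P -> (r, c, s') \in P -> s = s'.
Proof.
move=> Ppls t u; apply/eqP; apply/negPn/negP => ns.
have /(Ppls _ _ t u) : (r, c, s) != (r, c, s').
  by apply: contraNneq ns => -[->].
by rewrite /= !eqxx.
Qed.

Lemma pls_col P r c c' s :
  is_pls P -> (r, c, s) \in P -> (r, c', s) \in P -> c = c'.
Proof.
move=> Ppls t u; apply/eqP; apply/negPn/negP => ns.
have /(Ppls _ _ t u) : (r, c, s) != (r, c', s).
  by apply: contraNneq ns => -[->].
by rewrite /= !eqxx; case: eqP.
Qed.

Lemma pls_row P r r' c s :
  is_pls P -> (r, c, s) \in P -> (r', c, s) \in P -> r = r'.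
Proof.
move=> Ppls t u; apply/eqP; apply/negPn/negP => ns.
have /(Ppls _ _ t u) : (r, c, s) != (r', c, s).
  by apply: contraNneq ns => -[->].
by rewrite /= !eqxx; case: eqP.
Qed.

Lemma row_perm_ex W B r : latin_bitrade W B ->
  exists psi, perm_with_graph (syms_of_row W r) (row_graph W B r) psi.
Proof.
move=> [[_ _ Wp Bp] [WB BW]]; apply: perm_with_graph_ex.
- move=> s; rewrite inE => /existsP[c Wt]; have [_ _ [s' [[_ Bt] _]]] := WB _ _ _ Wt.
  by exists s'; apply/existsP; exists c; rewrite Wt.
- move=> s s' /existsP[c /andP[_ Bt]]; have [_ [c' [[_ Wt] _]] _] := BW _ _ _ Bt.
  by rewrite inE; apply/existsP; exists c'.
- move=> s x y /existsP[c /andP[Wc Bc]] /existsP[d /andP[Wd Bd]].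
  by move: Bd; rewrite -(pls_col Wp Wc Wd) => /(pls_sym Bp Bc).
- move=> x y s /existsP[c /andP[Wc Bc]] /existsP[d /andP[Wd Bd]].
  by move: Wd; rewrite -(pls_col Bp Bc Bd) => /(pls_sym Wp Wc).
Qed.

Lemma col_perm_ex W B c : latin_bitrade W B ->
  exists psi, perm_with_graph (rows_of_col W c) (col_graph W B c) psi.
Proof.
move=> [[_ _ Wp Bp] [WB BW]]; apply: perm_with_graph_ex.
- move=> r; rewrite inE => /existsP[s Wt]; have [[r' [[_ Bt] _]] _ _] := WB _ _ _ Wt.
  by exists r'; apply/existsP; exists s; rewrite Wt.
- move=> r r' /existsP[s /andP[_ Bt]]; have [_ _ [s' [[_ Wt] _]]] := BW _ _ _ Bt.
  by rewrite inE; apply/existsP; exists s'.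
- move=> r x y /existsP[s /andP[Ws Bs]] /existsP[d /andP[Wd Bd]].
  by move: Bd; rewrite -(pls_sym Wp Ws Wd) => /(pls_row Bp Bs).
- move=> x y r /existsP[s /andP[Ws Bs]] /existsP[d /andP[Wd Bd]].
  by move: Wd; rewrite -(pls_sym Bp Bs Bd) => /(pls_row Wp Ws).
Qed.

Lemma sym_perm_ex W B s : latin_bitrade W B ->
  exists psi, perm_with_graph (cols_of_sym W s) (sym_graph W B s) psi.
Proof.
move=> [[_ _ Wp Bp] [WB BW]]; apply: perm_with_graph_ex.
- move=> c; rewrite inE => /existsP[r Wt]; have [_ [c' [[_ Bt] _]] _] := WB _ _ _ Wt.
  by exists c'; apply/existsP; exists r; rewrite Wt.
- move=> c c' /existsP[r /andP[_ Bt]]; have [[r' [[_ Wt] _]] _ _] := BW _ _ _ Bt.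
  by rewrite inE; apply/existsP; exists r'.
- move=> c x y /existsP[r /andP[Wr Br]] /existsP[d /andP[Wd Bd]].
  by move: Bd; rewrite -(pls_row Wp Wr Wd) => /(pls_col Bp Br).
- move=> x y c /existsP[r /andP[Wr Br]] /existsP[d /andP[Wd Bd]].
  by move: Wd; rewrite -(pls_row Bp Br Bd) => /(pls_col Wp Wr).
Qed.

End LatinBitrades.

(* Main.v *)
Require Import Defs.
From mathcomp Require Import all_boot all_order all_algebra all_fingroup.

(* Let A be the abelian group generated by all rows, columns and symbols, with
   the relations r + c + s = 0 for (r, c, s) in W. Suppose that two distinct
   rows p, q become equal in A: then p - q is an integral combination, with
   coefficients a, of the relators. The triples of W are the edges of a
   bipartite graph on columns and symbols, and a is a 1-cycle of this graph.
   Taking the rows as faces gives a cell structure on the sphere, each edge e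
   lying between its white row x e and the row x' e of the black triple with
   the same column and symbol; the Euler characteristic makes a a boundary:
   a e = b (x e) - b (x' e). Let K be the set of rows where b is maximal. Every
   edge leaving K (x e in K, x' e not in K) has a e >= 1, while these values sum
   to at most 1 because the coefficients of p - q on K do; so exactly one edge
   leaves K, and by conservation exactly one enters it. The boundary of K is
   then a cycle with two edges, which therefore have the same column and the
   same symbol, contradicting that W is a partial latin square.
   Columns and symbols follow by rotating the coordinates. Finally, the Smith
   normal form separates p from q in some quotient Z/N of A, and a common
   multiple of these N over all pairs yields one finite group. *)

Set Implicit Arguments.
Unset Strict Implicit.
Unset Printing Implicit Defensive.
Import Order.TTheory GRing.Theory Num.Theory.
Local Open Scope ring_scope.

(** * Sums over finite types *)

Lemma sum_enum_val (V : nmodType) (T : finType) (G : T -> V) :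
  \sum_(i < #|T|) G (enum_val i) = \sum_t G t.
Proof. by rewrite -big_enum_val. Qed.

Lemma sum_delta (A : pzSemiRingType) (T : finType) (t : T) (G : T -> A) :
  \sum_s (t == s)%:R * G s = G t.
Proof.
rewrite (bigD1 t) //= eqxx mul1r big1 ?addr0 // => s.
by rewrite eq_sym => /negPf->; rewrite mul0r.
Qed.

(** * First homology of the sphere whose edges are the white triples *)

Section ClosedSurface.

(* E is the set of white triples e = (x e, y e, z e), x' e is the row of the
   black triple (x' e, y e, z e), and tauY e (resp. tauZ e) is the other white
   triple that has the row and the column (resp. symbol) of this black one. *)
Variables (X Y Z E : finType) (x x' : E -> X) (y : E -> Y) (z : E -> Z).
Variables tauY tauZ : E -> E.
Hypotheses (tauY_inj : injective tauY) (tauZ_inj : injective tauZ).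
Hypotheses (y_tauY : forall e, y (tauY e) = y e).
Hypotheses (z_tauZ : forall e, z (tauZ e) = z e).
Hypotheses (x_tauY : forall e, x (tauY e) = x' e).
Hypotheses (x_tauZ : forall e, x (tauZ e) = x' e).

(** [tauY] permutes the edges at each vertex [c], and [x] after [tauY] is [x']. *)
Lemma sum_across_Y (V : nmodType) (F : X -> V) c :
  \sum_(e | y e == c) F (x' e) = \sum_(e | y e == c) F (x e).
Proof.
rewrite [RHS](reindex_inj tauY_inj) /=.
by apply: eq_big => e; rewrite ?y_tauY ?x_tauY.
Qed.

Lemma sum_across_Z (V : nmodType) (F : X -> V) c :
  \sum_(e | z e == c) F (x' e) = \sum_(e | z e == c) F (x e).
Proof.
rewrite [RHS](reindex_inj tauZ_inj) /=.
by apply: eq_big => e; rewrite ?z_tauZ ?x_tauZ.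
Qed.

Lemma sum_across (V : nmodType) (F : X -> V) :
  \sum_e F (x' e) = \sum_e F (x e).
Proof.
rewrite [RHS](reindex_inj tauY_inj) /=.
by apply: eq_bigr => e _; rewrite x_tauY.
Qed.

Hypothesis x_conn : forall K : {set X}, K != set0 -> K != setT ->
  exists2 e, x e \in K & x' e \notin K.
Hypothesis yz_conn : forall (K : {set Y}) (L : {set Z}),
  (forall e, (y e \in K) = (z e \in L)) -> K != set0 -> K = setT /\ L = setT.
Hypothesis E_gt0 : (0 < #|E|)%N.
Hypothesis euler : (#|X| + #|Y| + #|Z| = #|E| + 2)%N.

(** Dimension count: connectedness bounds the left kernels of [A] (faces against edges) and of [D^T]
    (vertices against edges) by dimension one, so [euler] makes the ranks of [A] and [D] add up to
    at least [#|E|]. As [A *m D = 0], the row space of [A] is the whole kernel of [D]. *)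
Lemma cycle_is_boundary (F : fieldType) (a : E -> F) :
  (forall c, \sum_(e | y e == c) a e = 0) ->
  (forall s, \sum_(e | z e == s) a e = 0) ->
  exists b : X -> F, forall e, a e = b (x e) - b (x' e).
Proof.
move=> aY aZ.
pose A : 'M[F]_(#|X|, #|E|) := \matrix_(i, j)
  ((x (enum_val j) == enum_val i)%:R - (x' (enum_val j) == enum_val i)%:R).
pose DY : 'M[F]_(#|E|, #|Y|) :=
  \matrix_(i, j) (y (enum_val i) == enum_val j)%:R.
pose DZ : 'M[F]_(#|E|, #|Z|) :=
  \matrix_(i, j) (z (enum_val i) == enum_val j)%:R.
pose D := row_mx DY DZ.
have mulA (u : 'rV[F]_#|X|) j : (u *m A) 0 j =
    u 0 (enum_rank (x (enum_val j))) - u 0 (enum_rank (x' (enum_val j))).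
  rewrite mxE.
  transitivity (\sum_t ((x (enum_val j) == t)%:R - (x' (enum_val j) == t)%:R)
                        * u 0 (enum_rank t)).
    rewrite -(sum_enum_val (T := X)); apply: eq_bigr => i _.
    by rewrite enum_valK mxE mulrC.
  under eq_bigr do rewrite mulrBl.
  by rewrite sumrB !sum_delta.
have mulDY (u : 'rV[F]_#|E|) j : (u *m DY) 0 j =
    \sum_(e | y e == enum_val j) u 0 (enum_rank e).
  rewrite mxE [RHS]big_mkcond -(sum_enum_val (T := E)); apply: eq_bigr => i _.
  by rewrite enum_valK mxE; case: eqP => _; rewrite ?mulr1 ?mulr0.
have mulDZ (u : 'rV[F]_#|E|) j : (u *m DZ) 0 j =
    \sum_(e | z e == enum_val j) u 0 (enum_rank e).
  rewrite mxE [RHS]big_mkcond -(sum_enum_val (T := E)); apply: eq_bigr => i _.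
  by rewrite enum_valK mxE; case: eqP => _; rewrite ?mulr1 ?mulr0.
have AD0 : A *m D = 0.
  apply/row_matrixP => i; rewrite row_mul row0 rowE.
  set u := delta_mx _ _; rewrite mul_mx_row.
  apply/rowP => j; rewrite [RHS]mxE mxE; case: splitP => k _.
    rewrite mulDY; under eq_bigr do rewrite mulA enum_rankK.
    by rewrite sumrB (sum_across_Y (fun r => u 0 (enum_rank r))) subrr.
  rewrite mulDZ; under eq_bigr do rewrite mulA enum_rankK.
  by rewrite sumrB (sum_across_Z (fun r => u 0 (enum_rank r))) subrr.
have kerA : (\rank (kermx A) <= 1)%N.
  apply: leq_trans (rank_leq_row (const_mx 1 : 'rV[F]_#|X|)).
  apply: mxrankS; apply/rV_subP => u /sub_kermxP uA.
  have ux e : u 0 (enum_rank (x e)) = u 0 (enum_rank (x' e)).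
    by apply/eqP; rewrite -subr_eq0 -{1 2}[e]enum_rankK -mulA uA mxE.
  have /card_gt0P[e0 _] := E_gt0.
  pose K := [set r | u 0 (enum_rank r) == u 0 (enum_rank (x e0))].
  have KT : K = setT.
    apply/eqP/negPn/negP => /x_conn [].
      by apply/set0Pn; exists (x e0); rewrite inE.
    by move=> e; rewrite !inE ux => ->.
  apply/submxP; exists (u 0 (enum_rank (x e0)))%:M.
  apply/rowP => i; rewrite mul_scalar_mx !mxE mulr1.
  by have := in_setT (enum_val i); rewrite -KT inE enum_valK => /eqP.
have kerD : (\rank (kermx D^T) <= 1)%N.
  (* The incidence matrix [D] is unsigned, so a kernel vector takes opposite values at the column
     and the symbol of an edge. *)
  pose alt : 'rV[F]_(#|Y| + #|Z|) := row_mx (const_mx 1) (const_mx (-1)).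
  apply: leq_trans (rank_leq_row alt).
  apply: mxrankS; apply/rV_subP => u /sub_kermxP.
  rewrite -[u]hsubmxK; set v := lsubmx u; set w := rsubmx u.
  rewrite tr_row_mx mul_row_col => uD.
  have vw e : v 0 (enum_rank (y e)) = - w 0 (enum_rank (z e)).
    apply/eqP; rewrite -addr_eq0; apply/eqP.
    move/rowP/(_ (enum_rank e)): uD; rewrite !mxE => <-; congr (_ + _).
      rewrite (bigD1 (enum_rank (y e))) //= big1 => [|i].
        by rewrite addr0 !mxE !enum_rankK eqxx mulr1.
      rewrite !mxE enum_rankK => /eqP ni; case: eqP; last by rewrite mulr0.
      by move=> ye; case: ni; rewrite ye enum_valK.
    rewrite (bigD1 (enum_rank (z e))) //= big1 => [|i].
      by rewrite addr0 !mxE !enum_rankK eqxx mulr1.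
    rewrite !mxE enum_rankK => /eqP ni; case: eqP; last by rewrite mulr0.
    by move=> ye; case: ni; rewrite ye enum_valK.
  have /card_gt0P[e0 _] := E_gt0; set k := v 0 (enum_rank (y e0)).
  pose K := [set c | v 0 (enum_rank c) == k].
  pose L := [set s | - w 0 (enum_rank s) == k].
  have [] := @yz_conn K L; first by move=> e; rewrite !inE vw.
    by apply/set0Pn; exists (y e0); rewrite inE.
  move=> KT LT; apply/submxP; exists k%:M.
  rewrite mul_mx_row !mul_scalar_mx; congr row_mx; apply/rowP => i.
    have := in_setT (enum_val i).
    by rewrite -KT inE enum_valK !mxE mulr1 => /eqP.
  have := in_setT (enum_val i).
  rewrite -LT inE enum_valK !mxE mulrN1 => /eqP <-.
  by rewrite opprK.
have sAK : (A <= kermx D)%MS by apply/sub_kermxP.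
have sKA : (kermx D <= A)%MS.
  rewrite -(mxrank_leqif_sup sAK) eqn_leq mxrankS //=.
  move: kerA kerD; rewrite !mxrank_ker mxrank_tr !leq_subLR => hA hD.
  have := leq_add hA hD.
  by rewrite addnA euler addnACA leq_add2r [(\rank D + _)%N]addnC.
pose v : 'rV[F]_#|E| := \row_i a (enum_val i).
have /submxP[u uA] : (v <= A)%MS.
  apply: submx_trans sKA; apply/sub_kermxP.
  rewrite mul_mx_row; apply/rowP => j; rewrite !mxE; case: splitP => k _.
    by rewrite mulDY; under eq_bigr do rewrite mxE enum_rankK; rewrite aY.
  by rewrite mulDZ; under eq_bigr do rewrite mxE enum_rankK; rewrite aZ.
exists (fun r => u 0 (enum_rank r)) => e.
by move/rowP/(_ (enum_rank e)): uA; rewrite mulA mxE !enum_rankK.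
Qed.

Hypothesis yz_inj : forall e f, y e = y f -> z e = z f -> e = f.

Lemma no_unit_source_sink (a : E -> int) (p q : X) : p != q ->
  (forall c, \sum_(e | y e == c) a e = 0) ->
  (forall s, \sum_(e | z e == s) a e = 0) ->
  (forall r, \sum_(e | x e == r) a e = (r == p)%:R - (r == q)%:R) -> False.
Proof.
move=> npq aY aZ aX.
have [||b ab] := @cycle_is_boundary rat (fun e => (a e)%:~R).
- by move=> c; rewrite -rmorph_sum /= aY.
- by move=> c; rewrite -rmorph_sum /= aZ.
pose m := [arg max_(r > p) b r]%O.
have bm r : b r <= b m.
  by rewrite /m; case: arg_maxP => //= i _; apply.
pose K := [set r | b r == b m].
(* A constant [b] would make [a] vanish, but [a] sums to 1 over the row [p]. *)
have KnT : K != setT.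
  apply/eqP => KT; have bE r : b r = b m.
    by have := in_setT r; rewrite -KT inE => /eqP.
  have := aX p; rewrite eqxx (negPf npq) subr0 big1 // => e _.
  by apply/eqP; rewrite -(intr_eq0 rat) ab !bE subrr.
have [e0 e0K e0K'] : exists2 e, x e \in K & x' e \notin K.
  by apply: x_conn => //; apply/set0Pn; exists m; rewrite inE.
have a_in e : x e \in K -> x' e \in K -> a e = 0.
  rewrite !inE => /eqP h1 /eqP h2; apply/eqP.
  by rewrite -(intr_eq0 rat) ab h1 h2 subrr.
(* An integer with positive image in the rationals is at least 1. *)
have a_out e : x e \in K -> x' e \notin K -> 1 <= a e.
  rewrite !inE => /eqP h1 h2; rewrite -gtz0_ge1 -(ltr0z rat) ab h1 subr_gt0.
  by rewrite lt_neqAle h2 bm.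
(* A second leaving edge would bring the sum of [a] over the edges with [x e] in [K] to at least 2,
   while the coefficients of p - q sum to at most 1 on [K]. *)
have out_unique e : x e \in K -> x' e \notin K -> e = e0.
  move=> eK eK'; apply/eqP/negPn/negP => ne.
  have : \sum_(r in K) ((r == p)%:R - (r == q)%:R) <= 1 :> int.
    apply: (@le_trans _ _ (\sum_(r in K) (r == p)%:R)).
      by apply: ler_sum => r _; rewrite lerBlDr lerDl ler0n.
    have [pK|pK] := boolP (p \in K).
      by rewrite (bigD1 p) //= eqxx big1 ?addr0 // => r /andP[_ /negPf->].
    by rewrite big1 ?ler01 // => r rK; case: eqP => // rp; rewrite -rp rK in pK.
  rewrite (eq_bigr _ (fun r _ => esym (aX r))).
  have <- : \sum_(f | x f \in K) a f = \sum_(r in K) \sum_(f | x f == r) a f.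
    rewrite (partition_big x (mem K)) //=; apply: eq_bigr => r rK.
    by apply: eq_bigl => f; case: eqP => [->|]; rewrite ?rK ?andbF.
  rewrite (bigD1 e) //= (bigD1 e0) ?e0K 1?eq_sym //=.
  apply/negP; rewrite -ltNge.
  apply: (@lt_le_trans _ _ (1 + 1)) => //; apply: lerD; first exact: a_out.
  apply: (le_trans (a_out _ e0K e0K')); rewrite lerDl.
  apply: sumr_ge0 => f /andP[/andP[fK _] _].
  have [fK'|/(a_out _ fK)] := boolP (x' f \in K); first by rewrite a_in.
  exact: le_trans.
(* Equally many edges have [x] in [K] and [x'] in [K], so an entering edge must balance [e0]. *)
have [e1 e1K e1K'] : exists2 e, x' e \in K & x e \notin K.
  apply/exists_inP; rewrite -[[exists _ in _, _]]negbK; apply/negP.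
  rewrite negb_exists_in => /forall_inP inK.
  have := sum_across (fun r => (r \in K) : nat).
  apply/eqP; rewrite neq_ltn; apply/orP; left.
  rewrite (bigD1 e0) // [X in (_ < X)%N](bigD1 e0) //= e0K (negPf e0K').
  rewrite ltnS leq_sum // => e _.
  by case: (boolP (x' e \in K)) => // /inK /negbNE ->.
(* [P] will be the set of edges at one vertex: if it contains the entering [e1], balance demands a
   leaving edge in [P], which can only be [e0]. *)
have in_out (P : pred E) :
    \sum_(e | P e) ((x' e \in K) : nat) = \sum_(e | P e) ((x e \in K) : nat) ->
    P e1 -> P e0.
  move=> sumP Pe1; apply/negPn/negP => nPe0; move/eqP: sumP; rewrite gtn_eqF //.
  rewrite (bigD1 e1) // [X in (_ < X)%N](bigD1 e1) //= e1K (negPf e1K').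
  rewrite ltnS leq_sum // => e /andP[Pe _].
  have [eK|//] := boolP (x e \in K); have [//|eK'] := boolP (x' e \in K).
  by move: nPe0; rewrite -(out_unique e) // Pe.
have /eqP ye : y e0 == y e1.
  apply: (in_out (fun e => y e == y e1)) => //.
  exact: (sum_across_Y (fun r => (r \in K) : nat)).
have /eqP ze : z e0 == z e1.
  apply: (in_out (fun e => z e == z e1)) => //.
  exact: (sum_across_Z (fun r => (r \in K) : nat)).
by move: e1K'; rewrite -(yz_inj ye ze) e0K.
Qed.

End ClosedSurface.

(** * Integral spans and residues modulo [N] *)

(** In Smith coordinates, lying in the span means that each diagonal entry divides the matching
    coordinate of [v']. Where this fails, that coordinate, read modulo a suitable [N], vanishes on
    the rows of [M] but not on [v]. *)
Lemma not_int_span_mod m n (M : 'M[int]_(m, n)) (v : 'rV[int]_n) :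
  (forall a : 'rV_m, v <> a *m M) ->
  exists (N : nat) (f : 'cV[int]_n),
    [/\ (0 < N)%N, forall i, (N%:Z %| (M *m f) i ord0)%Z
      & ~~ (N%:Z %| (v *m f) ord0 ord0)%Z].
Proof.
move=> nspan; have [L uL [Q uQ [d _ MLQ]]] := int_Smith_normal_form M.
set D := (X in L *m X *m Q) in MLQ.
(* Columns beyond the [m]-th have no diagonal entry; the value 0 makes divisibility force the
   coordinate to vanish. *)
pose v' := v *m invmx Q; pose dl (j : 'I_n) := if (j < m)%N then d`_j else 0.
have [/forallP dv|] := boolP [forall j, (dl j %| v' ord0 j)%Z].
  pose a : 'rV[int]_m :=
    \row_i (if insub (val i) is Some j then (v' ord0 j %/ d`_i)%Z else 0).
  case: (nspan (a *m invmx L)); rewrite MLQ !mulmxA mulmxKV //.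
  rewrite -[v](mulmxKV uQ) -/v'; congr (_ *m _); apply/rowP => j.
  have := dv j; rewrite /dl [(a *m D) 0 j]mxE; case: ifP => [lt_jm|ge_jm].
    move=> dvj; rewrite (bigD1 (Ordinal lt_jm)) //= big1 => [|i ne_ij].
      rewrite addr0 [a _ _]mxE [D _ _]mxE /= eqxx mulr1n insubT //= => lt_jn.
      by rewrite -{1}(divzK dvj);
        congr ((v' ord0 _ %/ _)%Z * _); apply: val_inj.
    rewrite !mxE; case: eqP => [ij|]; last by rewrite mulr0n mulr0.
    by case/eqP: ne_ij; apply: val_inj.
  rewrite dvd0z => /eqP->; rewrite big1 // => i _; rewrite !mxE.
  by case: eqP => [ij|]; [rewrite -ij ltn_ord in ge_jm | rewrite mulr0n mulr0].
rewrite negb_forall => /existsP[j ndv].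
(* For a zero diagonal entry any modulus kills the rows of [M]; one exceeding the nonzero coordinate
   of [v'] in absolute value cannot divide it. *)
pose N := if dl j == 0 then `|v' ord0 j|.+1%N else `|dl j|%N.
have Ndl : (N%:Z %| dl j)%Z.
  by rewrite /N; case: (altP eqP) => [->|_]; rewrite ?dvdz0 // dvdzE.
exists N, (col j (invmx Q)); split.
- by rewrite /N; case: ifP => // /negbT; rewrite absz_gt0.
- move=> i; rewrite colE mulmxA MLQ mulmxK // -mulmxA -colE mxE.
  apply: rpred_sum => k _; rewrite [col j D k 0]mxE [D k j]mxE.
  case: eqP => [kj|]; last by rewrite mulr0n mulr0 dvdz0.
  rewrite mulr1n dvdz_mull //; move: Ndl.
  by rewrite /dl -kj ltn_ord.
- rewrite colE mulmxA -colE mxE -/v' /N.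
  case: (altP eqP) => [dl0|_]; last first.
    by rewrite dvdzE absz_nat -dvdzE.
  move: ndv; rewrite dl0 dvd0z -absz_gt0 => vgt0.
  by rewrite dvdzE /= gtnNdvd.
Qed.

(** The bound excludes [N <= 1], where ['Z_N] has two elements by convention. *)
Lemma intr_Zp_eq0 N (u : int) : (1 < N)%N ->
  (u%:~R == 0 :> 'Z_N) = (N%:Z %| u)%Z.
Proof.
move=> N1; have natE n : (n%:R == 0 :> 'Z_N) = (N %| n)%N.
  by rewrite -val_eqE /= val_Zp_nat.
by case: u => n; rewrite ?NegzE ?mulrNz ?oppr_eq0 -?pmulrn natE dvdzE ?abszN.
Qed.

(** * Cyclic rotation of rows, columns and symbols *)

Section Rotation.

Variables R C S : finType.
Implicit Types W B : {set R * C * S}.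

Definition rotate W : {set C * S * R} :=
  [set t | (t.2, t.1.1, t.1.2) \in W].

Lemma in_rotate W r c s : ((c, s, r) \in rotate W) = ((r, c, s) \in W).
Proof. by rewrite inE. Qed.

Lemma rotate_has_mates W B : has_mates W B -> has_mates (rotate W) (rotate B).
Proof.
move=> WB c s r; rewrite in_rotate.
move=> /WB[[r' [Br Ur]] [c' [Bc Uc]] [s' [Bs Us]]].
split; [exists c' | exists s' | exists r'].
- by split=> [|d]; rewrite in_rotate //; apply: Uc.
- by split=> [|d]; rewrite in_rotate //; apply: Us.
- by split=> [|d]; rewrite in_rotate //; apply: Ur.
Qed.

Lemma rotate_pls W : is_pls W -> is_pls (rotate W).
Proof.
move=> Wp [[c s] r] [[c' s'] r']; rewrite !in_rotate => Wt Wu ne.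
rewrite /= addnC addnA; apply: (Wp _ _ Wt Wu).
by apply: contra ne => /eqP[-> -> ->].
Qed.

Lemma rotate_neq0 W : W != set0 -> rotate W != set0.
Proof.
case/set0Pn=> [[[r c] s] Wt]; apply/set0Pn.
by exists (c, s, r); rewrite in_rotate.
Qed.

Lemma rotate_bitrade W B :
  latin_bitrade W B -> latin_bitrade (rotate W) (rotate B).
Proof.
move=> [[W0 B0 Wp Bp] [WB BW]]; split; first split.
- exact: rotate_neq0.
- exact: rotate_neq0.
- exact: rotate_pls.
- exact: rotate_pls.
by split; apply: rotate_has_mates.
Qed.

Lemma rotateU W B : rotate (W :|: B) = rotate W :|: rotate B.
Proof. by apply/setP => t; rewrite !inE. Qed.

Lemma rotateI W B : rotate (W :&: B) = rotate W :&: rotate B.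
Proof. by apply/setP => t; rewrite !inE. Qed.

Lemma rotate0 : rotate set0 = set0.
Proof. by apply/setP => t; rewrite !inE. Qed.

Lemma card_rotate W : #|rotate W| = #|W|.
Proof.
pose f (t : C * S * R) := (t.2, t.1.1, t.1.2).
have f_inj : injective f by move=> [[? ?] ?] [[? ?] ?] [-> -> ->].
rewrite -(card_imset (mem (rotate W)) f_inj).
apply: eq_card => -[[r c] s]; apply/imsetP/idP => [[[[c' s'] r']]|Wt].
  by rewrite in_rotate => Wt [-> -> ->].
by exists (c, s, r); rewrite ?in_rotate.
Qed.

Lemma used_rows_rotate W : used_rows (rotate W) = used_cols W.
Proof.
apply/setP => c; apply/imsetP/imsetP => -[[[a b] d] Wt /= ->].
  by exists (d, a, b); rewrite -?in_rotate.
by exists (b, d, a); rewrite ?in_rotate.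
Qed.

Lemma used_cols_rotate W : used_cols (rotate W) = used_syms W.
Proof.
apply/setP => c; apply/imsetP/imsetP => -[[[a b] d] Wt /= ->].
  by exists (d, a, b); rewrite -?in_rotate.
by exists (b, d, a); rewrite ?in_rotate.
Qed.

Lemma used_syms_rotate W : used_syms (rotate W) = used_rows W.
Proof.
apply/setP => c; apply/imsetP/imsetP => -[[[a b] d] Wt /= ->].
  by exists (d, a, b); rewrite -?in_rotate.
by exists (b, d, a); rewrite ?in_rotate.
Qed.

End Rotation.

Lemma rotate3 (R C S : finType) (W : {set R * C * S}) :
  rotate (rotate (rotate W)) = W.
Proof. by apply/setP => -[[r c] s]; rewrite !in_rotate. Qed.

(** Rotation has order three, so two more rotations bring a splitting of the rotated pair back to
    the original. *)
Lemma rotate_connected (R C S : finType) (W B : {set R * C * S}) :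
  connected_bitrade W B -> connected_bitrade (rotate W) (rotate B).
Proof.
move=> conn [W1 [B1 [W2 [B2 [T1 T2 W12 WU BU]]]]]; apply: conn.
exists (rotate (rotate W1)), (rotate (rotate B1)).
exists (rotate (rotate W2)), (rotate (rotate B2)); split.
- by do 2!apply: rotate_bitrade.
- by do 2!apply: rotate_bitrade.
- by rewrite -!rotateI W12 !rotate0.
- by rewrite -!rotateU -WU rotate3.
- by rewrite -!rotateU -BU rotate3.
Qed.

(** With rows as faces, columns and symbols as vertices and white triples as edges, the equation is
    Euler's formula for the sphere, free of subtraction. *)
Definition spherical_bitrade (R C S : finType) (W B : {set R * C * S}) :=
  [/\ latin_bitrade W B, connected_bitrade W B
    & (#|used_rows W| + #|used_cols W| + #|used_syms W| = #|W| + 2)%N].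

Lemma rotate_spherical (R C S : finType) (W B : {set R * C * S}) :
  spherical_bitrade W B -> spherical_bitrade (rotate W) (rotate B).
Proof.
move=> [T conn eW]; split; first exact: rotate_bitrade.
  exact: rotate_connected.
rewrite used_rows_rotate used_cols_rotate used_syms_rotate card_rotate -eW.
by rewrite addnC addnA.
Qed.

(** * The surface of a spherical bitrade *)

Section Rows.

Variables (R C S : finType) (W B : {set R * C * S}).
Hypothesis sph : spherical_bitrade W B.

Let Wpls : is_pls W. Proof. by case: sph => -[[]]. Qed.
Let Bpls : is_pls B. Proof. by case: sph => -[[]]. Qed.
Let WB : has_mates W B. Proof. by case: sph => -[_ []]. Qed.
Let BW : has_mates B W. Proof. by case: sph => -[_ []]. Qed.

(** On the triples of [W] and [B], such a [P] is a union of components of the graph joining a white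
    and a black triple that agree in two coordinates. *)
Definition mate_invariant (P : pred (R * C * S)) : Prop :=
  [/\ forall r r' c s, (r, c, s) \in W -> (r', c, s) \in B ->
        P (r, c, s) = P (r', c, s),
      forall r c c' s, (r, c, s) \in W -> (r, c', s) \in B ->
        P (r, c, s) = P (r, c', s)
    & forall r c s s', (r, c, s) \in W -> (r, c, s') \in B ->
        P (r, c, s) = P (r, c, s')].

Lemma mate_invariantC P :
  mate_invariant P -> mate_invariant (fun t => ~~ P t).
Proof.
move=> [Pr Pc Ps]; split=> [r r' c s|r c c' s|r c s s'] Wt Bt; congr negb.
- exact: Pr.
- exact: Pc.
- exact: Ps.
Qed.

Lemma part_bitrade (P : pred (R * C * S)) t0 :
  mate_invariant P ->
  t0 \in W -> P t0 -> latin_bitrade [set t in W | P t] [set t in B | P t].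
Proof.
move=> [Pr Pc Ps] Wt0 Pt0; split; first split.
- by apply/set0Pn; exists t0; rewrite inE Wt0.
- case: t0 Wt0 Pt0 => [[r c] s] Wt Pt; have [[r' [[_ Bt] _]] _ _] := WB Wt.
  by apply/set0Pn; exists (r', c, s); rewrite inE Bt -(Pr _ _ _ _ Wt Bt).
- by move=> t u; rewrite !inE => /andP[Wt _] /andP[Wu _]; apply: Wpls.
- by move=> t u; rewrite !inE => /andP[Wt _] /andP[Wu _]; apply: Bpls.
split=> r c s; rewrite inE => /andP[Wt Pt].
  have [[r' [[nr Br] Ur]] [c' [[nc Bc] Uc]] [s' [[ns Bs] Us]]] := WB Wt.
  split; [exists r' | exists c' | exists s']; split.
  - by rewrite inE Br -(Pr _ _ _ _ Wt Br).
  - by move=> d [nd]; rewrite inE => /andP[Bd _]; apply: Ur.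
  - by rewrite inE Bc -(Pc _ _ _ _ Wt Bc).
  - by move=> d [nd]; rewrite inE => /andP[Bd _]; apply: Uc.
  - by rewrite inE Bs -(Ps _ _ _ _ Wt Bs).
  - by move=> d [nd]; rewrite inE => /andP[Bd _]; apply: Us.
have [[r' [[nr Br] Ur]] [c' [[nc Bc] Uc]] [s' [[ns Bs] Us]]] := BW Wt.
split; [exists r' | exists c' | exists s']; split.
- by rewrite inE Br (Pr _ _ _ _ Br Wt).
- by move=> d [nd]; rewrite inE => /andP[Bd _]; apply: Ur.
- by rewrite inE Bc (Pc _ _ _ _ Bc Wt).
- by move=> d [nd]; rewrite inE => /andP[Bd _]; apply: Uc.
- by rewrite inE Bs (Ps _ _ _ _ Bs Wt).
- by move=> d [nd]; rewrite inE => /andP[Bd _]; apply: Us.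
Qed.

(** Otherwise [P] and its complement would split the bitrade. *)
Lemma mate_invariant_const (P : pred (R * C * S)) t0 t1 :
  mate_invariant P ->
  t0 \in W -> t1 \in W -> P t0 -> P t1.
Proof.
move=> Pinv Wt0 Wt1 Pt0; apply/negPn/negP => Pt1.
case: sph => _ conn _; apply: conn.
exists [set t in W | P t], [set t in B | P t].
exists [set t in W | ~~ P t], [set t in B | ~~ P t]; split.
- exact: part_bitrade Pinv Wt0 Pt0.
- exact: part_bitrade (mate_invariantC Pinv) Wt1 Pt1.
- by apply/setP => t; rewrite !inE; case: (P t); rewrite ?andbF.
- by apply/setP => t; rewrite !inE; case: (P t); rewrite ?andbF ?orbF andbT.
- by apply/setP => t; rewrite !inE; case: (P t); rewrite ?andbF ?orbF andbT.
Qed.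

Lemma row_difference_not_spanned (p q : R) (a : R * C * S -> int) :
  p \in used_rows W -> q \in used_rows W -> p != q ->
  (forall r, \sum_(t in W | t.1.1 == r) a t = (r == p)%:R - (r == q)%:R) ->
  (forall c, \sum_(t in W | t.1.2 == c) a t = 0) ->
  (forall s, \sum_(t in W | t.2 == s) a t = 0) -> False.
Proof.
move=> pW qW npq aR aC aS.
pose E := {t : R * C * S | t \in W}.
pose white t (Wt : t \in W) : E := exist (fun t => t \in W) t Wt.
pose X := {r : R | r \in used_rows W}.
pose Y := {c : C | c \in used_cols W}.
pose Z := {s : S | s \in used_syms W}.
pose x (e : E) : X := exist _ (val e).1.1 (imset_f (fun t => t.1.1) (valP e)).
pose y (e : E) : Y := exist _ (val e).1.2 (imset_f (fun t => t.1.2) (valP e)).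
pose z (e : E) : Z := exist _ (val e).2 (imset_f (fun t => t.2) (valP e)).
have E_ind (P : E -> Prop) :
    (forall r c s (Wt : (r, c, s) \in W), P (white _ Wt)) ->
    forall e, P e.
  by move=> PE [[[r c] s] Wt].
(* The row of the black mate is used in [W] because the black triple has a white mate in that
   row. *)
have [x' x'B] : exists x' : E -> X,
    forall e, (val (x' e), (val e).1.2, (val e).2) \in B.
  apply: (@fin_all_exists _ _
    (fun e (r : X) => (val r, (val e).1.2, (val e).2) \in B)).
  elim/E_ind => r c s Wt; have [[r' [[_ Bt] _]] _ _] := WB Wt.
  have [_ _ [s' [[_ Wt'] _]]] := BW Bt.
  by exists (x (white _ Wt')).
have [tauY tauYP] : exists tau : E -> E,
    forall e, y (tau e) = y e /\ x (tau e) = x' e.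
  apply: (@fin_all_exists _ _ (fun e e' => y e' = y e /\ x e' = x' e)).
  elim/E_ind => r c s Wt; set e := white _ _.
  have [_ _ [s' [[_ Wt'] _]]] := BW (x'B e).
  by exists (white _ Wt'); split; apply: val_inj.
have [tauZ tauZP] : exists tau : E -> E,
    forall e, z (tau e) = z e /\ x (tau e) = x' e.
  apply: (@fin_all_exists _ _ (fun e e' => z e' = z e /\ x e' = x' e)).
  elim/E_ind => r c s Wt; set e := white _ _.
  have [_ [c' [[_ Wt'] _]] _] := BW (x'B e).
  by exists (white _ Wt'); split; apply: val_inj.
have E_inj (e f : E) : y e = y f -> z e = z f -> e = f.
  elim/E_ind: e => r c s Wt; elim/E_ind: f => r' c' s' Wt' [cc] [ss].
  apply: val_inj; rewrite /= -cc -ss; congr (_, _, _).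
  by apply: (pls_row Wpls Wt); rewrite cc ss.
(* Equal images give two black triples in one row and column, hence with one symbol. *)
have tauY_inj : injective tauY.
  move=> e f ef; have yef : y e = y f.
    by rewrite -(proj1 (tauYP e)) ef (proj1 (tauYP f)).
  apply: E_inj (yef) _; apply: val_inj => /=.
  apply: (pls_sym Bpls (x'B e)).
  have := x'B f; rewrite -(proj2 (tauYP e)) ef (proj2 (tauYP f)).
  by case: yef => ->.
have tauZ_inj : injective tauZ.
  move=> e f ef; have zef : z e = z f.
    by rewrite -(proj1 (tauZP e)) ef (proj1 (tauZP f)).
  apply: E_inj (zef); apply: val_inj => /=.
  apply: (pls_col Bpls (x'B e)).
  have := x'B f; rewrite -(proj2 (tauZP e)) ef (proj2 (tauZP f)).
  by case: zef => ->.
have sum_sub (P : pred (R * C * S)) :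
    \sum_(e : E | P (val e)) a (val e) = \sum_(t in W | P t) a t.
  by rewrite [RHS]big_sub_cond.
apply: (@no_unit_source_sink X Y Z E x x' y z tauY tauZ tauY_inj tauZ_inj
  _ _ _ _ _ _ _ _ E_inj (fun e => a (val e)) (exist _ p pW) (exist _ q qW)).
- by move=> e; have [] := tauYP e.
- by move=> e; have [] := tauZP e.
- by move=> e; have [] := tauYP e.
- by move=> e; have [] := tauZP e.
(* If no edge leaves [K], then by counting none enters, so membership in [K] is invariant under
   mates and [K] is everything. *)
- move=> K /set0Pn[r0 r0K] KnT.
  apply/exists_inP; rewrite -[[exists _ in _, _]]negbK; apply/negP.
  rewrite negb_exists_in => /forall_inP KK.
  have Keq e : (x' e \in K) = (x e \in K).
    have sumK := @sum_across X E x x' tauY tauY_inj (fun e => proj2 (tauYP e))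
      nat (fun r => (r \in K) : nat).
    apply/idP/idP => [x'K|/KK/negbNE//]; apply/negPn/negP => xK.
    move/eqP: sumK; rewrite gtn_eqF // (bigD1 e) //=.
    rewrite [X in (_ < X)%N](bigD1 e) //= x'K (negPf xK) ltnS leq_sum // => f _.
    by case: (boolP (x f \in K)) => // /KK/negbNE->.
  pose P (t : R * C * S) := [exists r : X, (r \in K) && (val r == t.1.1)].
  have PE (r : X) c s : P (val r, c, s) = (r \in K).
    apply/existsP/idP => [[r' /andP[r'K /eqP/val_inj <-]] //|rK].
    by exists r; rewrite rK eqxx.
  have PT t : t \in W -> P t.
    have /imsetP[t0 Wt0 r0E] := valP r0.
    move=> Wt; apply: (@mate_invariant_const P t0) => // [|].
      split=> // r r' c s Ws Bs.
      rewrite (PE (x (white _ Ws))) -Keq -(PE _ c s).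
      by rewrite (pls_row Bpls (x'B (white _ Ws)) Bs).
    by case: t0 r0E {Wt0} => [[r c] s] /= <-; rewrite PE.
  case/eqP: KnT; apply/setP => r; rewrite inE.
  have /imsetP[[[r' c] s] Wt rE] := valP r.
  by rewrite -(PE r c s) rE; apply: PT.
(* Only a change of column needs care: both columns meet the same symbol in [W], and [K] at either
   column agrees with [L] at that symbol. *)
- move=> K L KL /set0Pn[c0 c0K].
  pose P (t : R * C * S) := [exists c : Y, (c \in K) && (val c == t.1.2)].
  have PE r (c : Y) s : P (r, val c, s) = (c \in K).
    apply/existsP/idP => [[c' /andP[c'K /eqP/val_inj <-]] //|cK].
    by exists c; rewrite cK eqxx.
  have PT t : t \in W -> P t.
    have /imsetP[t0 Wt0 c0E] := valP c0.
    move=> Wt; apply: (@mate_invariant_const P t0) => // [|].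
      split=> // r c c' s Ws Bs.
      have [[r' [[_ Wr'] _]] _ _] := BW Bs.
      rewrite (PE _ (y (white _ Ws))) (PE _ (y (white _ Wr'))) !KL.
      by congr (_ \in L); apply: val_inj.
    by case: t0 c0E {Wt0} => [[r c] s] /= <-; rewrite PE.
  have yK e : y e \in K.
    by rewrite -(PE (val e).1.1 _ (val e).2) PT //; elim/E_ind: e.
  split; apply/setP => v; rewrite inE.
    have /imsetP[t Wt vE] := valP v.
    by have -> : v = y (white _ Wt); [apply: val_inj | apply: yK].
  have /imsetP[t Wt vE] := valP v.
  by have -> : v = z (white _ Wt); [apply: val_inj | rewrite -KL; apply: yK].
- by have /imsetP[t Wt _] := pW; apply/card_gt0P; exists (white _ Wt).
- by rewrite !card_sig; case: sph.
- by [].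
- by move=> c; rewrite (sum_sub (fun t => t.1.2 == val c)).
- by move=> s; rewrite (sum_sub (fun t => t.2 == val s)).
- by move=> r; rewrite (sum_sub (fun t => t.1.1 == val r)) aR.
Qed.

End Rows.

(** * Labellings modulo [N] *)

Section Labels.

Variables R C S : finType.
Notation V := (R + C + S)%type.
Implicit Types (W B : {set R * C * S}) (phi : V -> int).

Definition vrow (r : R) : V := inl (inl r).
Definition vcol (c : C) : V := inl (inr c).
Definition vsym (s : S) : V := inr s.

(** Integer representatives of a homomorphism into Z/N from the abelian group with relations r + c +
    s = 0. *)
Definition labelling W (N : nat) phi := forall r c s, (r, c, s) \in W ->
  (N%:Z %| phi (vrow r) + phi (vcol c) + phi (vsym s))%Z.

(** A single predicate on [V * V], false on mixed kinds, lets one family of labellings serve rows,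
    columns and symbols. *)
Definition distinct_used W (u v : V) : bool :=
  match u, v with
  | inl (inl r), inl (inl r') =>
      [&& r \in used_rows W, r' \in used_rows W & r != r']
  | inl (inr c), inl (inr c') =>
      [&& c \in used_cols W, c' \in used_cols W & c != c']
  | inr s, inr s' =>
      [&& s \in used_syms W, s' \in used_syms W & s != s']
  | _, _ => false
  end.

(** The rows of [M] are the relators, padded by zero rows outside [W]. Since p - q is not in their
    span, [not_int_span_mod] gives a functional whose values are the labels. *)
Lemma separate_rows W B p q : spherical_bitrade W B ->
  distinct_used W (vrow p) (vrow q) ->
  exists (N : nat) phi, [/\ (0 < N)%N, labelling W N phi
    & ~~ (N%:Z %| phi (vrow p) - phi (vrow q))%Z].
Proof.
move=> sph /and3P[pW qW npq].
pose inc (t : R * C * S) (v : V) := match v with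
  | inl (inl r) => t.1.1 == r | inl (inr c) => t.1.2 == c
  | inr s => t.2 == s end.
pose M : 'M[int]_(#|{: R * C * S}|, #|{: V}|) :=
  \matrix_(i, j) ((enum_val i \in W) && inc (enum_val i) (enum_val j))%:R.
pose w : 'rV[int]_#|{: V}| :=
  \row_j ((enum_val j == vrow p)%:R - (enum_val j == vrow q)%:R).
have [|N [f [N0 Mf wf]]] := @not_int_span_mod _ _ M w.
  move=> a wE; pose a' t := a ord0 (enum_rank t).
  have aE v : \sum_(t in W | inc t v) a' t =
      (v == vrow p)%:R - (v == vrow q)%:R.
    move/rowP/(_ (enum_rank v)): wE; rewrite !mxE enum_rankK => ->.
    rewrite big_mkcond -(sum_enum_val (fun t => if _ then _ else _)).
    apply: eq_bigr => i _; rewrite /a' enum_valK mxE enum_rankK.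
    by case: (_ && _); rewrite ?mulr1 ?mulr0.
  apply: (row_difference_not_spanned sph pW qW npq (a := a')) => [r|c|s].
  - exact: (aE (vrow r)).
  - exact: (aE (vcol c)).
  - exact: (aE (vsym s)).
exists N, (fun v => f (enum_rank v) ord0); split=> // [r c s Wt|].
  have := Mf (enum_rank (r, c, s)); rewrite mxE.
  under eq_bigr => j do rewrite mxE enum_rankK Wt /= -{2}[j]enum_valK.
  rewrite (sum_enum_val (fun v => (inc (r, c, s) v)%:R * f (enum_rank v) ord0)).
  by rewrite !big_sumType /= !sum_delta.
move: wf; rewrite mxE.
under eq_bigr => j do rewrite mxE -{3}[j]enum_valK mulrBl.
rewrite (sum_enum_val (fun v => (v == vrow p)%:R * f (enum_rank v) ord0
                          - (v == vrow q)%:R * f (enum_rank v) ord0)).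
rewrite sumrB.
under eq_bigr do rewrite eq_sym.
rewrite sum_delta.
under eq_bigr do rewrite eq_sym.
by rewrite sum_delta.
Qed.

End Labels.

(** Columns are the rows of the rotated bitrade; its labels are carried back by the cyclic
    renaming. *)
Lemma separate_cols (R C S : finType) (W B : {set R * C * S}) p q :
  spherical_bitrade W B -> distinct_used W (vcol _ _ p) (vcol _ _ q) ->
  exists (N : nat) phi, [/\ (0 < N)%N, labelling W N phi
    & ~~ (N%:Z %| phi (vcol _ _ p) - phi (vcol _ _ q))%Z].
Proof.
move=> /rotate_spherical sph; rewrite /= -used_rows_rotate.
case/(separate_rows sph) => N [phi [N0 lab sep]].
exists N, (fun v => match v with
  | inl (inl r) => phi (vsym _ _ r) | inl (inr c) => phi (vrow _ _ c)
  | inr s => phi (vcol _ _ s) end); split=> // r c s.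
by rewrite -in_rotate => /lab; rewrite /= addrC addrA.
Qed.

Lemma separate_syms (R C S : finType) (W B : {set R * C * S}) p q :
  spherical_bitrade W B -> distinct_used W (vsym _ _ p) (vsym _ _ q) ->
  exists (N : nat) phi, [/\ (0 < N)%N, labelling W N phi
    & ~~ (N%:Z %| phi (vsym _ _ p) - phi (vsym _ _ q))%Z].
Proof.
move=> /rotate_spherical sph; rewrite /= -used_cols_rotate.
case/(separate_cols sph) => N [phi [N0 lab sep]].
exists N, (fun v => match v with
  | inl (inl r) => phi (vsym _ _ r) | inl (inr c) => phi (vrow _ _ c)
  | inr s => phi (vcol _ _ s) end); split=> // r c s.
by rewrite -in_rotate => /lab; rewrite /= addrC addrA.
Qed.

(** * The finite abelian group *)

Lemma genus0_card (R C S : finType) (W : {set R * C * S}) : genus W = 0 ->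
  (#|used_rows W| + #|used_cols W| + #|used_syms W| = #|W| + 2)%N.
Proof.
move/eqP; rewrite mulf_eq0 invr_eq0 pnatr_eq0 orbF.
rewrite -!addrA -!opprD !addrA subr_eq0.
by rewrite -[1 + 1]/(2%:R) -!natrD eqr_nat => /eqP; rewrite addnC => ->.
Qed.

Theorem theorem1p2 (R C S : finType) (W : {set R * C * S}) :
  spherical_trade W ->
  exists gT : finGroupType, abelian [set: gT] /\ embeds_in W gT.
Proof.
move=> [B [T _ conn /genus0_card eW]].
have sph : spherical_bitrade W B by [].
pose V := (R + C + S)%type.
have sep (i : V * V) : exists Nphi : nat * (V -> int),
    [/\ (0 < Nphi.1)%N, labelling W Nphi.1 Nphi.2
      & distinct_used W i.1 i.2 ->
        ~~ (Nphi.1%:Z %| Nphi.2 i.1 - Nphi.2 i.2)%Z].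
  have [Di|/negPf Di] := boolP (distinct_used W i.1 i.2); last first.
    (* A pair with nothing to separate gets the zero labelling modulo 1. *)
    by exists (1%N, fun=> 0); split=> [//|r c s _|]; rewrite ?Di ?dvd1z.
  suff [N [phi [N0 lab nd]]] : exists (N : nat) phi,
      [/\ (0 < N)%N, labelling W N phi & ~~ (N%:Z %| phi i.1 - phi i.2)%Z].
    by exists (N, phi).
  case: i Di => -[[r|c]|s] [[r'|c']|s'] //= Di.
  - exact: separate_rows sph Di.
  - exact: separate_cols sph Di.
  - exact: separate_syms sph Di.
have [F FP] := fin_all_exists sep.
(* The factor 2 ensures [1 < N] even if all moduli are 1. *)
pose N := (2 * \prod_i (F i).1)%N.
(* Multiplication by [d i] embeds the integers modulo [(F i).1] into those modulo [N]. *)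
pose d i := (N %/ (F i).1)%N.
have NE i : N%:Z = (d i)%:Z * (F i).1%:Z.
  by rewrite -PoszM divnK // dvdn_mull // (bigD1 i) //= dvdn_mulr.
have N1 : (1 < N)%N.
  by apply: leq_pmulr; apply: prodn_gt0 => i; case: (FP i).
(* One coordinate per pair of generators, so each relevant pair is separated somewhere. *)
pose psi (v : V) : 'rV['Z_N]_#|{: V * V}| :=
  \row_j ((d (enum_val j))%:Z * (F (enum_val j)).2 v)%:~R.
have psi_inj u v : psi u = psi v -> ~~ distinct_used W u v.
  move=> /rowP/(_ (enum_rank (u, v))); rewrite !mxE enum_rankK => /eqP.
  rewrite -subr_eq0 -rmorphB -mulrBr intr_Zp_eq0 // (NE (u, v)).
  have [F0 _ sepF] := FP (u, v).
  have Fd : (d (u, v))%:Z != 0.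
    apply/eqP => d0; have := NE (u, v); rewrite d0 mul0r => -[N0].
    by rewrite N0 in N1.
  rewrite dvdz_mul2l //.
  by move=> dv; apply/negP => /sepF /=; rewrite dv.
exists 'rV['Z_N]_#|{: V * V}|; split; first exact: FinRing.zmod_abelian.
(* The sign on symbols turns r + c + s = 0 into r + c = k(s). *)
exists (fun r => psi (vrow _ _ r)), (fun c => psi (vcol _ _ c)),
  (fun s => - psi (vsym _ _ s)); split.
- by move=> r r' rW r'W /psi_inj /=; rewrite rW r'W negbK => /eqP.
- by move=> c c' cW c'W /psi_inj /=; rewrite cW c'W negbK => /eqP.
- by move=> s s' sW s'W /oppr_inj/psi_inj /=; rewrite sW s'W negbK => /eqP.
move=> r c s Wt; rewrite FinRing.zmodMgE; apply/eqP; rewrite -addr_eq0.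
apply/eqP/rowP => j; rewrite !mxE -!rmorphD -!mulrDr; apply/eqP.
have [_ lab _] := FP (enum_val j).
by rewrite intr_Zp_eq0 // (NE (enum_val j)) dvdz_mul //; apply: lab.
Qed.
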